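(* Let $(s,x,m,u)$ be an extremal of problem (P), with multiplier $\alpha$ and costate $\psi$. Then (up to modification of $u$ on a null set) the control $u$ is of one of the following types, the intervals listed being consecutive subintervals of $]0,T[$: - Type Ia: $u=(1,0)$ on $]0,t_1[,\ ]t_1,T[$; - Type Ib: $u=(1,u_{sing},0)$ on $]0,t_1[,\ ]t_1,t_2[,\ ]t_2,T[$; - Type IIa: $u=(0,1,0)$ on $]0,t_1[,\ ]t_1,t_2[,\ ]t_2,T[$; - Type IIb: $u=(0,1,u_{sing},0)$ on $]0,t_1[,\ ]t_1,t_2[,\ ]t_2,t_3[,\ ]t_3,T[$; - Type III: $u=(1,0,1,0)$ on $]0,t_1[,\ ]t_1,t_2[,\ ]t_2,t_3[,\ ]t_3,T[$.
   Context: Problem (P). Fix $T>0$, $0<g<1$, $0<m_T<m_0$ with $0<\Delta m:=m_0-m_T<T$. Let $\varphi:\mathbb{R}\to\mathbb{R}$ be differentiable with $\varphi(0)=0$, $\varphi'(x)>0$ for all $x$, $\varphi$ twice smooth for $x\neq 0$, $\varphi''(x)<0$ for $x<0$ and $\varphi''(x)>0$ for $x>0$. The problem is to maximize $s(T)$ over processes $(s,x,m,u)$ on $[0,T]$ ($u$ measurable, $s,x,m$ Lipschitz) satisfying $$\dot s=x,\quad \dot x=u-\varphi(x)-g,\quad \dot m=-u,\quad 0\le u\le 1,\quad s(0)=0,\ x(0)=0,\ m(0)=m_0,\ m(T)\ge m_T,$$ with $x(T)$ free. Maximum principle (MP), normalized so that the cost multiplier equals 1 (the abnormal case being impossible). An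 admissible process satisfies the MP (is an extremal) if there are a constant $\alpha\ge 0$ and a Lipschitz function $\psi$ on $[0,T]$ with $$\dot\psi=-1+\psi\,\varphi'(x),\quad \psi(T)=0,\quad \alpha\,(m(T)-m_T)=0,$$ the function $x+\psi\,(u-\varphi(x)-g)-\alpha u$ is constant (a.e.) on $[0,T]$, and for a.e. $t$: $u(t)=1$ if $\psi(t)>\alpha$, $u(t)=0$ if $\psi(t)<\alpha$, $u(t)\in[0,1]$ if $\psi(t)=\alpha$. Notation: ''$u=(u_1,u_2,\dots)$ on $\Delta_1,\Delta_2,\dots$'' means $u(t)=u_1$ on $\Delta_1$, $u(t)=u_2$ on $\Delta_2$, etc. The symbol $u_{sing}$ (singular control) on an interval means that $\psi(t)\equiv\alpha$ on that interval and $u(t)=u_{sing}(t)=\varphi(x(t))+g$ there. *)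

(* Defs.v *)
From HB Require Import structures.
From mathcomp Require Import all_boot all_order all_algebra.
From mathcomp Require Import all_classical all_reals all_analysis.
From mathcomp Require Import measurable_realfun.

Set Implicit Arguments.
Unset Strict Implicit.
Unset Printing Implicit Defensive.

Import Order.TTheory GRing.Theory Num.Theory.
Import numFieldNormedType.Exports.

Local Open Scope classical_set_scope.
Local Open Scope ring_scope.

(* Processes are represented by functions defined on the whole of R, but only
   their restrictions to [0, T] are constrained. Almost-everywhere conditions
   are imposed on the open interval, where the two-sided derivative only
   depends on that restriction. *)
Definition ae_on (R : realType) (T : R) (P : R -> Prop) : Prop :=
  {ae @lebesgue_measure R, forall t : R, 0 < t < T -> P t}.

(* Measurability with respect to the completed (Lebesgue) sigma-algebra; the
   canonical one on R is only the Borel sigma-algebra. *)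
Definition lebesgue_measurable_fun (R : realType) (D : set R) (f : R -> R)
    : Prop :=
  @measurable_fun _ _
    (g_sigma_algebraType (completed_algebra_gen (@lebesgue_measure R)))
    (measurableTypeR R) D f.

Record friction_law (R : realType) (phi : R -> R) : Prop := FrictionLaw {
  friction_derivable : forall x : R, derivable phi x 1 ;
  friction0 : phi 0 = 0 ;
  friction_deriv_gt0 : forall x : R, 0 < phi^`()%classic x ;
  friction_twice_derivable :
    forall x : R, x != 0 -> derivable (phi^`()%classic) x 1 ;
  friction_deriv2_continuous :
    forall x : R, x != 0 -> {for x, continuous (phi^`(2)%classic)} ;
  friction_deriv2_lt0 : forall x : R, x < 0 -> phi^`(2)%classic x < 0 ;
  friction_deriv2_gt0 : forall x : R, 0 < x -> 0 < phi^`(2)%classic x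
}.

Record admissible (R : realType) (T g m0 mT : R) (phi : R -> R)
    (s x m u : R -> R) : Prop := Admissible {
  adm_u_measurable : lebesgue_measurable_fun `[0, T] u ;
  adm_s_lipschitz : [lipschitz s t | t in `[0, T]] ;
  adm_x_lipschitz : [lipschitz x t | t in `[0, T]] ;
  adm_m_lipschitz : [lipschitz m t | t in `[0, T]] ;
  adm_s_ode : ae_on T (fun t => is_derive t (1 : R) s (x t)) ;
  adm_x_ode :
    ae_on T (fun t => is_derive t (1 : R) x (u t - phi (x t) - g)) ;
  adm_m_ode : ae_on T (fun t => is_derive t (1 : R) m (- u t)) ;
  adm_u_range : ae_on T (fun t => 0 <= u t <= 1) ;
  adm_s0 : s 0 = 0 ;
  adm_x0 : x 0 = 0 ;
  adm_m0 : m 0 = m0 ;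
  adm_mT : mT <= m T
}.

(* An admissible process satisfying the maximum principle with multiplier
   alpha and costate psi, the multiplier of the cost being normalized to 1. *)
Record extremal (R : realType) (T g m0 mT : R) (phi : R -> R)
    (s x m u : R -> R) (alpha : R) (psi : R -> R) : Prop := Extremal {
  ext_admissible : admissible T g m0 mT phi s x m u ;
  ext_alpha_ge0 : 0 <= alpha ;
  ext_psi_lipschitz : [lipschitz psi t | t in `[0, T]] ;
  ext_psi_ode :
    ae_on T (fun t =>
      is_derive t (1 : R) psi (- 1 + psi t * phi^`()%classic (x t))) ;
  ext_psiT : psi T = 0 ;
  ext_complementarity : alpha * (m T - mT) = 0 ;
  ext_hamiltonian_cst : exists c : R, ae_on T (fun t =>
    x t + psi t * (u t - phi (x t) - g) - alpha * u t = c) ;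
  ext_maximum : ae_on T (fun t =>
    [/\ alpha < psi t -> u t = 1,
        psi t < alpha -> u t = 0 &
        psi t = alpha -> 0 <= u t <= 1])
}.

Definition ctrl_cst (R : realType) (u : R -> R) (c a b : R) : Prop :=
  forall t : R, a < t < b -> u t = c.

Definition ctrl_sing (R : realType) (g : R) (phi x : R -> R) (alpha : R)
    (psi u : R -> R) (a b : R) : Prop :=
  forall t : R, a < t < b -> psi t = alpha /\ u t = phi (x t) + g.

Definition type_Ia (R : realType) (T : R) (u : R -> R) : Prop :=
  exists t1 : R,
    [/\ 0 < t1 < T, ctrl_cst u 1 0 t1 & ctrl_cst u 0 t1 T].

Definition type_Ib (R : realType) (T g : R) (phi x : R -> R) (alpha : R)
    (psi u : R -> R) : Prop :=
  exists t1 t2 : R,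
    [/\ [/\ 0 < t1, t1 < t2 & t2 < T],
        ctrl_cst u 1 0 t1,
        ctrl_sing g phi x alpha psi u t1 t2 &
        ctrl_cst u 0 t2 T].

Definition type_IIa (R : realType) (T : R) (u : R -> R) : Prop :=
  exists t1 t2 : R,
    [/\ [/\ 0 < t1, t1 < t2 & t2 < T],
        ctrl_cst u 0 0 t1,
        ctrl_cst u 1 t1 t2 &
        ctrl_cst u 0 t2 T].

Definition type_IIb (R : realType) (T g : R) (phi x : R -> R) (alpha : R)
    (psi u : R -> R) : Prop :=
  exists t1 t2 t3 : R,
    [/\ [/\ 0 < t1, t1 < t2, t2 < t3 & t3 < T],
        ctrl_cst u 0 0 t1,
        ctrl_cst u 1 t1 t2,
        ctrl_sing g phi x alpha psi u t2 t3 &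
        ctrl_cst u 0 t3 T].

Definition type_III (R : realType) (T : R) (u : R -> R) : Prop :=
  exists t1 t2 t3 : R,
    [/\ [/\ 0 < t1, t1 < t2, t2 < t3 & t3 < T],
        ctrl_cst u 1 0 t1,
        ctrl_cst u 0 t1 t2,
        ctrl_cst u 1 t2 t3 &
        ctrl_cst u 0 t3 T].

(* Main.v *)
Require Import Defs.
From HB Require Import structures.
From mathcomp Require Import all_boot all_order all_algebra.
From mathcomp Require Import all_classical all_reals all_analysis.
From mathcomp Require Import measurable_realfun.
From mathcomp Require Import lra ring.

Set Implicit Arguments.
Unset Strict Implicit.
Unset Printing Implicit Defensive.

Import Order.TTheory GRing.Theory Num.Theory.
Import numFieldNormedType.Exports.
Local Open Scope classical_set_scope.
Local Open Scope ring_scope.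

(** Write sg = psi - alpha and h(y) = y - alpha (phi(y) + g). The maximum
    condition turns the Hamiltonian into x - psi (phi(x) + g) + max(sg, 0), and
    its constant value is x(T), because psi(T) = 0 < alpha. Hence
    h(x) - x(T) = sg (phi(x) + g) where sg <= 0 and
    h(x) - x(T) = - sg (1 - g - phi(x)) where sg >= 0. Since
    0 < phi(x) + g < 1 along the trajectory, h(x) <= x(T) always holds, with
    equality exactly at the zeros of sg ([ext_switching_diagram]). So the
    switchings are read off from the level set of height x(T) of the scalar
    function h, whose slope 1 - alpha phi' increases up to 0 and decreases after
    it. The velocity falls strictly where sg < 0 and rises
    strictly where sg > 0.

    Let q be the last zero of sg and z = x(q). After q the velocity sweeps
    [x(T), z], so h stays below the level on [x(T), z[; and as the slope of h
    cannot be positive, negative and positive again, z is the only point at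
    which h reaches the level from below ([crest_unique]). A coasting phase
    (u = 0) between two zeros of sg would start at such a point, hence at z, and
    end at a velocity in ]x(T), z[ that lies on the level, which is impossible.
    A thrust phase (u = 1) between two zeros ends at z, and from then on x = z
    and sg = 0 until q ([middle_rise]). What remains is an optional initial
    coasting phase, one thrust phase, an optional singular arc at the constant
    velocity z, and a final coasting phase ([switching_phases]). A singular arc
    cannot come right at the start or right after an initial coasting phase:
    its velocity would be z <= 0, a critical point of h, while h rises to z
    inside the half-line where its slope is nondecreasing. *)

(** * Lipschitz functions with an almost everywhere given derivative *)
#[global] Instance ae_lebesgue_filter (R : realType) :
  Filter (almost_everywhere (@lebesgue_measure R)).
Proof. exact: (ae_filter_ringOfSetsType lebesgue_measure). Qed.

Section AlmostEverywhereCalculus.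
Context {R : realType}.
Implicit Types (f : R -> R) (a b t d L : R).

Lemma derive_increment f t d (e : R) :
  is_derive t 1 f d -> 0 < e ->
  exists2 r : R, 0 < r &
    forall k : R, `|k| < r -> `|f (t + k) - f t - d * k| <= e * `|k|.
Proof.
move=> [df <-] e0; have /cvgrPdist_le /(_ e e0) := df.
move=> [r /= r0 Hr]; exists r => // k kr.
have [->|k0] := eqVneq k 0; first by rewrite addr0 mulr0 subrr subr0 normr0 mulr0.
have He : `|'D_1 f t - k^-1 * (f (k * 1 + t) - f t)| <= e.
  by apply: (Hr k) => //; rewrite /ball /= sub0r normrN.
move: He; rewrite -(ler_pM2r (_ : 0 < `|k|)) ?normr_gt0 // -normrM.
by rewrite -normrN mulrBl mulr1 [k + t]addrC mulrAC mulVf // mul1r opprB.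
Qed.

Lemma derive_local_min f t d (r : R) : is_derive t 1 f d -> 0 < r ->
  (forall k : R, `|k| < r -> f t <= f (t + k)) -> d = 0.
Proof.
move=> df r0 ft; apply/eqP; rewrite -normr_le0 leNgt; apply/negP => d0.
have e0 : 0 < `|d| / 2 by lra.
have [q q0 Hq] := derive_increment df e0.
pose h := Num.min q r / 2.
have [hq hr h0] : [/\ h < q, h < r & 0 < h].
  by rewrite /h; case: (leP q r) => ?; split; lra.
have nh : `|h| = h by rewrite gtr0_norm.
have := Hq h; have := Hq (- h); have := ft h; have := ft (- h).
rewrite !normrN nh => /(_ hr) H1 /(_ hr) H2 /(_ hq) H3 /(_ hq) H4.
move: H3 H4; rewrite !ler_norml => /andP[_ H3] /andP[_ H4].
have : 0 < `|d| * h by rewrite mulr_gt0.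
by move: H3 H4; case: (ger0P d) => ? ? ? ?; lra.
Qed.

Lemma lebesgue_measure_oo a b : a < b ->
  @lebesgue_measure R `]a, b[%classic = (b - a)%:E.
Proof. by move=> ab; rewrite lebesgue_measure_itv /= lte_fin ab. Qed.

Lemma ae_interval_point (P : R -> Prop) a b :
  a < b -> {ae @lebesgue_measure R, forall t : R, P t} ->
  exists2 t : R, a < t < b & P t.
Proof.
move=> ab aeP; apply: contrapT => nP.
have : (@lebesgue_measure R).-negligible `]a, b[%classic.
  apply: negligibleS aeP => t; rewrite /= in_itv /= => abt Pt.
  by apply: nP; exists t.
move=> ab0; have : @lebesgue_measure R `]a, b[%classic = 0%E.
  exact: (@measure_negligible _ (measurableTypeR R) R lebesgue_measure).
by rewrite lebesgue_measure_oo // => -[]; lra.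
Qed.

Lemma ae_neq a : {ae @lebesgue_measure R, forall t : R, t <> a}.
Proof.
exists [set a]; split; [exact: measurable_set1|exact: lebesgue_measure_set1|].
by move=> t /= /contrapT.
Qed.

(** Fundamental theorem of calculus in the form needed for the state equations.
    The bad times lie in an open set U of small measure. Adding to f the term
    L |U /\ ]a, t]| compensates the worst possible decrease at bad times, and
    adding e2 (t - a) gives room at good ones, so that the sum F cannot stop
    being at least F(a) at any time before b. *)
Lemma ae_derive_ge0_le f a b L :
  (forall s t : R, a <= s <= t -> t <= b -> - L * (t - s) <= f t - f s) ->
  {ae @lebesgue_measure R,
    forall t : R, a < t < b -> exists2 d : R, 0 <= d & is_derive t 1 f d} ->
  a <= b -> f a <= f b.
Proof.
wlog L0 : L / 0 <= L.
  move=> wl fL; apply: (wl `|L|) => // s t /andP[a_s st] tb.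
  apply: le_trans (fL _ _ _ tb); last by rewrite a_s.
  by have := ler_norm L; nra.
move=> fL aef ab; rewrite leNgt; apply/negP => fba.
pose z := f a - f b; have z0 : 0 < z by rewrite /z; lra.
pose e1 := z / (4 * (L + 1)); pose e2 := z / (4 * (b - a + 1)).
have e10 : 0 < e1 by rewrite divr_gt0 //; lra.
have e20 : 0 < e2 by rewrite divr_gt0 //; lra.
have Le1 : L * e1 <= z / 4.
  have -> : z / 4 = (L + 1) * e1 by rewrite /e1; field; lra.
  by nra.
have Le2 : e2 * (b - a) <= z / 4.
  have -> : z / 4 = (b - a + 1) * e2 by rewrite /e2; field; lra.
  by nra.
(* The endpoint a, where the derivative is unknown, is counted as a bad time. *)
pose N := ~` [set t | t <> a /\
  (a < t < b -> exists2 d : R, 0 <= d & is_derive t 1 f d)].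
have N0 : (@lebesgue_measure R).-negligible N.
  exact: (filterI (ae_neq a) aef).
have [U [oU NU]] := outer_measure_open_le N e10.
rewrite (proj1 (negligible_outer_measure N) N0) add0e => Ue1.
have mU : measurable U by exact: open_measurable.
pose mu := @lebesgue_measure R.
have muI t : (mu (U `&` `]a, t]%classic) <= e1%:E)%E.
  apply: le_trans Ue1; apply: le_measure; rewrite ?inE //.
  exact: measurableI.
have muIfin t : mu (U `&` `]a, t]%classic) \is a fin_num.
  by rewrite ge0_fin_numE ?measure_ge0 // (le_lt_trans (muI t)) // ltry.
pose g t := fine (mu (U `&` `]a, t]%classic)).
have ge1 t : g t <= e1 by rewrite -lee_fin /g fineK.
have g_mono s t : s <= t -> g s <= g t.
  move=> st; rewrite fine_le //; apply: le_measure; rewrite ?inE;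
    try exact: measurableI.
  by apply: setIS => u; rewrite /= !in_itv /= => /andP[-> /le_trans ->].
have ga : g a = 0.
  have -> : g a = fine (mu set0) by rewrite /g set_itv_ge ?bnd_simp ?ltxx // setI0.
  by have -> : mu set0 = 0%E by exact: measure0.
have g_step s t : a <= s -> s < t -> `]s, t[%classic `<=` U ->
    g s + (t - s) <= g t.
  move=> a_s st stU; rewrite -lee_fin EFinD /g !fineK //.
  have -> : ((t - s)%:E = mu `]s, t[%classic)%E.
    by rewrite /mu lebesgue_measure_oo.
  have <- : (mu ((U `&` `]a, s]%classic) `|` `]s, t[%classic) =
      mu (U `&` `]a, s]%classic) + mu `]s, t[%classic)%E.
    apply: measureU => //; first exact: measurableI.
    apply/seteqP; split => u //=; rewrite !in_itv /= => -[[_ /andP[_ us]]].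
    by rewrite ltNge us.
  apply: le_measure; rewrite ?inE;
    [by apply: measurableU => //; exact: measurableI|exact: measurableI|].
  move=> u [[Uu]|]; rewrite /= !in_itv /= => /andP[u1 u2].
    by split=> //; rewrite u1 /=; lra.
  by split; [apply: stU; rewrite /= in_itv /= u1|apply/andP; split; lra].
pose F t := f t + L * g t + e2 * (t - a).
have FL s t : a <= s <= t -> t <= b -> F s - L * (t - s) <= F t.
  move=> ast tb; have := fL s t ast tb.
  case/andP: ast => a_s st; have := g_mono _ _ st; rewrite /F; nra.
pose S := [set t | a <= t <= b /\ F a <= F t].
have Sa : S a by rewrite /S /= lexx ab.
have supS : has_sup S.
  by split; [exists a|exists b => t [/andP[]]].
pose s := sup S.
have sa : a <= s by exact: sup_upper_bound.
have sb : s <= b by apply: ge_sup; [exists a|move=> t [/andP[]]].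
have Fs : F a <= F s.
  apply/ler_addgt0Pr => eta eta0.
  have q0 : 0 < eta / (L + 1) by rewrite divr_gt0 //; lra.
  have [t St ts] := sup_adherent q0 supS.
  have tles : t <= s by exact: sup_upper_bound.
  case: St => /andP[at_ tb] Fat; rewrite -/s in ts.
  have := FL t s; rewrite at_ tles => /(_ isT sb).
  have : L * (s - t) <= L * (eta / (L + 1)) by apply: ler_wpM2l => //; lra.
  have : L * (eta / (L + 1)) <= eta.
    by rewrite mulrA ler_pdivrMr; nra.
  by lra.
have [sltb|bs] := ltP s b; last first.
  have sbE : s = b by apply/eqP; rewrite eq_le sb.
  move: Fs; rewrite sbE {1}/F ga subrr /F.
  have : L * g b <= L * e1 by apply: ler_wpM2l.
  by rewrite /z in z0 Le1 Le2 *; lra.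
suff [t [st tb Ft]] : exists t : R, [/\ s < t, t <= b & F s <= F t].
  suff : t <= s by lra.
  apply: sup_upper_bound => //; split; last exact: le_trans Ft.
  by apply/andP; split; lra.
have [Ns|] := pselect (N s).
  have [r r0 rU] : exists2 r : R, 0 < r & ball s r `<=` U.
    exact: (open_nbhs_nbhs (conj oU (NU _ Ns))).
  pose t := Num.min (s + r) b.
  have [st tb tr] : [/\ s < t, t <= b & t <= s + r].
    by rewrite /t; case: (leP (s + r) b) => ?; split; lra.
  exists t; split => //.
  have : g s + (t - s) <= g t.
    apply: g_step => // u; rewrite /= in_itv /= => /andP[su ut].
    by apply: rU; rewrite /ball /= distrC gtr0_norm; lra.
  have := fL s t; rewrite sa (ltW st) => /(_ isT tb); rewrite /F; nra.
rewrite /N /= notK => -[/eqP sNa].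
have sa' : a < s by rewrite lt_def sNa.
rewrite sa' sltb => /(_ isT)[d d0 df].
have [r r0 Hr] := derive_increment df e20.
pose k := Num.min (r / 2) (b - s).
have [k0 kr kb] : [/\ 0 < k, k < r & k <= b - s].
  by rewrite /k; case: (leP (r / 2) (b - s)) => ?; split; lra.
exists (s + k); split; [lra|lra|].
have := Hr k; rewrite gtr0_norm // => /(_ kr); rewrite ler_norml => /andP[H _].
have : L * g s <= L * g (s + k) by apply: ler_wpM2l => //; apply: g_mono; lra.
have : 0 <= d * k by rewrite mulr_ge0 // ltW.
by rewrite /F; lra.
Qed.

(** If f took the same value at both ends it would be constant, with zero
    derivative, by the previous lemma. *)
Lemma ae_derive_gt0_lt f a b L :
  (forall s t : R, a <= s <= t -> t <= b -> - L * (t - s) <= f t - f s) ->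
  {ae @lebesgue_measure R,
    forall t : R, a < t < b -> exists2 d : R, 0 < d & is_derive t 1 f d} ->
  a < b -> f a < f b.
Proof.
move=> fL aef ab.
have mono s t : a <= s -> s <= t -> t <= b -> f s <= f t.
  move=> a_s st tb; apply: (@ae_derive_ge0_le _ _ _ L) => // [u v /andP[su uv] vt|].
    by apply: fL; [apply/andP; split|]; lra.
  apply: filterS aef => u H /andP[su ut].
  by have [|d d0 df] := H _; [apply/andP; split; lra|exists d; rewrite // ltW].
rewrite lt_neqAle (mono a b) ?lexx ?(ltW ab) // andbT; apply/eqP => fab.
have [t /andP[at_ tb] Ht] := ae_interval_point ab aef.
have [|d d0 df] := Ht _; first by rewrite at_.
suff : d = 0 by lra.
apply: (derive_local_min df (_ : 0 < Num.min (t - a) (b - t))) => [|k].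
  by rewrite lt_min; apply/andP; split; lra.
rewrite lt_min => /andP[]; rewrite !ltr_norml => /andP[? ?] /andP[? ?].
have := mono t b; have := mono a (t + k).
move=> /(_ ltac:(lra) ltac:(lra) ltac:(lra)) /[swap].
move=> /(_ ltac:(lra) ltac:(lra) ltac:(lra)); lra.
Qed.

End AlmostEverywhereCalculus.

(** * Zeros of continuous functions *)

Section ContinuousFunctions.
Context {R : realType}.
Implicit Types (f : R -> R) (a b c t v : R).

Lemma continuous_itv f a b : continuous f -> {within `[a, b], continuous f}.
Proof. exact: continuous_subspaceT. Qed.

Lemma continuous_surj f a b v : continuous f -> a <= b ->
  Num.min (f a) (f b) <= v <= Num.max (f a) (f b) ->
  exists2 t : R, a <= t <= b & f t = v.
Proof.
move=> cf ab vf; have [t + ft] := IVT ab (continuous_itv cf) vf.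
by rewrite in_itv /=; exists t.
Qed.

Lemma continuous_lt_near f c t : continuous f -> f t < c ->
  exists2 r : R, 0 < r & forall u : R, `|u - t| < r -> f u < c.
Proof.
move=> cf ftc; have := cf t; move/cvgrPdist_lt => /(_ (c - f t)).
rewrite subr_gt0 => /(_ ftc) [r /= r0 Hr]; exists r => // u ut.
have := Hr u; rewrite /ball /= distrC => /(_ ut); rewrite ltr_norml; lra.
Qed.

Lemma last_preimage f a b c t0 : continuous f -> a <= t0 <= b -> f t0 = c ->
  exists t : R, [/\ t0 <= t <= b, f t = c & forall u : R, t < u <= b -> f u <> c].
Proof.
move=> cf at0b ft0.
pose A := `[t0, b]%classic `&` f @^-1` [set c].
have At0 : A t0 by split => //; rewrite /= in_itv /= lexx; case/andP: at0b.
have cA : compact A.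
  apply: (subclosed_compact _ (segment_compact (a := t0) (b := b))).
  - apply: closedI; first exact: itv_closed.
    by apply: preimage_closed; [move=> u _; exact: cf|exact: closed_eq].
  - by move=> u [].
have [] := @compact_EVT_max R R idfun A (ex_intro _ _ At0) cA.
  by apply: continuous_subspaceT => u; exact: cvg_id.
move=> t /set_mem [+ ft] tmax; rewrite /= in_itv /= => t0tb.
exists t; split => // u /andP[tu ub] fu.
have /tmax /= : u \in A.
  by apply/mem_set; split => //; rewrite /= in_itv /= ub andbT; lra.
by lra.
Qed.

Lemma first_preimage f a b c t0 : continuous f -> a <= t0 <= b -> f t0 = c ->
  exists t : R, [/\ a <= t <= t0, f t = c & forall u : R, a <= u < t -> f u <> c].
Proof.
move=> cf at0b ft0.
have cg : continuous (f \o -%R).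
  by move=> u; apply: continuous_comp; [exact: opp_continuous|exact: cf].
have [||t [tb ft tmax]] := @last_preimage _ (- b) (- a) c (- t0) cg.
- by apply/andP; split; lra.
- by rewrite /= opprK.
exists (- t); split => //; first by apply/andP; split; lra.
move=> u /andP[au ut]; have := tmax (- u); rewrite /= opprK; apply.
by apply/andP; split; lra.
Qed.

Lemma nonvanishing_sign f a b t0 : continuous f ->
  (forall t : R, a < t < b -> f t <> 0) -> a < t0 < b -> 0 < f t0 ->
  forall t : R, a < t < b -> 0 < f t.
Proof.
move=> cf f0 t0ab ft0 t tab; rewrite ltNge; apply/negP => ft.
have [[t1 t2] /= t12 tt] : exists2 p : R * R,
    p.1 <= p.2 & (p = (t0, t) \/ p = (t, t0)).
  by case: (leP t0 t) => [|/ltW] ?; [exists (t0, t)|exists (t, t0)] => //; auto.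
have [|r rt fr] := continuous_surj (f := f) (a := t1) (b := t2) (v := 0) cf t12.
  by case: tt => -[-> ->]; rewrite ge_min le_max ft (ltW ft0) ?orbT.
apply: (f0 r) => //; case: tt rt => -[-> ->]; lra.
Qed.

Lemma nonvanishing_signN f a b t0 : continuous f ->
  (forall t : R, a < t < b -> f t <> 0) -> a < t0 < b -> f t0 < 0 ->
  forall t : R, a < t < b -> f t < 0.
Proof.
move=> cf f0 t0ab ft0 t tab.
have cg : continuous (- f) by move=> u; apply: continuousN; exact: cf.
suff : 0 < (- f) t by rewrite /= oppr_gt0.
apply: (nonvanishing_sign cg _ t0ab) => //; last by rewrite /= oppr_gt0.
by move=> u /f0 fu /eqP; rewrite oppr_eq0 => /eqP.
Qed.

End ContinuousFunctions.

(** * Structure of the zeros of the switching function *)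

(** What the order of the phases depends on, apart from the control problem:
    [x] is the velocity, [sg] the switching function psi - alpha, [h] the
    function whose level [c] is reached exactly at the zeros of [sg], and [k]
    the derivative of [h]. The last two fields say that a singular velocity is
    a critical point of [h], and that [sg] is not negative off a single time, in
    which case the control would vanish almost everywhere. *)
Record switching_diagram (R : realType) (T c : R) (x sg h k : R -> R) : Prop :=
  SwitchingDiagram {
  sd_T : 0 < T ;
  sd_x : continuous x ;
  sd_sg : continuous sg ;
  sd_h : forall y : R, is_derive y 1 h (k y) ;
  sd_k_incr : forall y w : R, y <= w -> w <= 0 -> k y <= k w ;
  sd_k_decr : forall y w : R, 0 <= y -> y <= w -> k w <= k y ;
  sd_level : forall y w : R, y < w -> exists2 v : R, y < v < w & h v <> c ;
  sd_x0 : x 0 = 0 ;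
  sd_xT : x T = c ;
  sd_sgT : sg T < 0 ;
  sd_le : forall t : R, 0 <= t <= T -> h (x t) <= c ;
  sd_eq : forall t : R, 0 <= t <= T -> h (x t) = c <-> sg t = 0 ;
  sd_above : forall t : R, 0 <= t <= T -> sg t = 0 -> c < x t ;
  sd_fall : forall a b : R, 0 <= a -> a < b -> b <= T ->
    (forall t : R, a < t < b -> sg t < 0) -> x b < x a ;
  sd_rise : forall a b : R, 0 <= a -> a < b -> b <= T ->
    (forall t : R, a < t < b -> 0 < sg t) -> x a < x b ;
  sd_singular : forall a b : R, 0 <= a -> a < b -> b <= T ->
    (forall t : R, a < t < b -> sg t = 0) -> exists2 t : R, a < t < b & k (x t) = 0 ;
  sd_thrust : forall e : R, exists t : R, [/\ 0 < t < T, t <> e & 0 <= sg t]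
}.

Section SwitchingDiagram.
Context {R : realType} (T c : R) (x sg h k : R -> R).
Hypothesis D : switching_diagram T c x sg h k.

Lemma sd_h_continuous : continuous h.
Proof.
move=> y; apply: differentiable_continuous; apply/derivable1_diffP.
by have [] := sd_h D y.
Qed.

Lemma sd_mvt y w : y < w -> exists2 v : R, y < v < w & h w - h y = k v * (w - y).
Proof.
move=> yw; have [||v + hv] := MVT yw (f := h) (df := k).
- by move=> v _; exact: (sd_h D).
- exact/continuous_itv/sd_h_continuous.
by rewrite in_itv /=; exists v.
Qed.

Lemma sd_slope_gt0 y w : y < w -> h y < h w ->
  exists2 v : R, y < v < w & 0 < k v.
Proof.
move=> yw hyw; have [v vyw E] := sd_mvt yw; exists v => //.
have : 0 < k v * (w - y) by rewrite -E subr_gt0.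
by rewrite pmulr_lgt0 // subr_gt0.
Qed.

Lemma sd_slope_lt0 y w : y < w -> h w < h y ->
  exists2 v : R, y < v < w & k v < 0.
Proof.
move=> yw hyw; have [v vyw E] := sd_mvt yw; exists v => //.
have : k v * (w - y) < 0 by rewrite -E subr_lt0.
by rewrite pmulr_llt0 // subr_gt0.
Qed.

Lemma sd_slope_quasiconcave y v w : y < v < w -> 0 <= k y -> 0 <= k w -> 0 <= k v.
Proof.
move=> /andP[yv vw] ky kw; have [v0|v0] := leP v 0.
  by apply: le_trans ky _; apply: (sd_k_incr D) => //; exact: ltW.
by apply: le_trans kw _; apply: (sd_k_decr D); exact: ltW.
Qed.

(** By the mean value theorem the slope would be positive, negative, and positive
    again, although it is quasiconcave. *)
Lemma sd_no_second_rise y1 y w1 w : y1 < y -> y < w1 -> w1 < w ->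
  h y1 < h y -> h w1 < h y -> h w1 < h w -> False.
Proof.
move=> y1y yw1 w1w h1 h2 h3.
have [v1 v1b k1] := sd_slope_gt0 y1y h1.
have [v2 v2b k2] := sd_slope_lt0 yw1 h2.
have [v3 v3b k3] := sd_slope_gt0 w1w h3.
by have := @sd_slope_quasiconcave v1 v2 v3 ltac:(lra) (ltW k1) (ltW k3); lra.
Qed.

Lemma sd_lt t : 0 <= t <= T -> sg t <> 0 -> h (x t) < c.
Proof.
move=> tT sgt; rewrite lt_neqAle (sd_le D) // andbT; apply/eqP.
by move/(sd_eq D tT).
Qed.

Lemma sd_between a b v : 0 <= a -> a <= b -> b <= T ->
  Num.min (x a) (x b) < v < Num.max (x a) (x b) ->
  exists2 t : R, a < t < b & x t = v.
Proof.
move=> a0 ab bT /andP[v1 v2].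
have [|t /andP[at_ tb] xt] := continuous_surj (sd_x D) ab (v := v).
  by rewrite !ltW.
exists t => //; rewrite !lt_neqAle at_ tb !andbT; apply/andP; split.
  by apply: contraTneq v2 => ta; move: v1; rewrite ta xt;
    case: (leP v (x b)) => ?; rewrite ?ltxx //; lra.
by apply: contraTneq v2 => ta; move: v1; rewrite -ta xt;
    case: (leP (x a) v) => ?; rewrite ?ltxx //; lra.
Qed.

Lemma sd_exists_zero : exists2 t : R, 0 <= t <= T & sg t = 0.
Proof.
have [t [tT _ sgt]] := sd_thrust D 0.
have tleT : t <= T by lra.
have [|r rt sgr] := continuous_surj (sd_sg D) tleT (v := 0).
  by rewrite ge_min le_max sgt (ltW (sd_sgT D)) orbT.
by exists r => //; lra.
Qed.

Section LastZero.
Variable q : R.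
Hypothesis q_itv : 0 <= q <= T.
Ltac lra_q := move: q_itv => ?; lra.
Hypothesis sgq : sg q = 0.
Hypothesis q_last : forall t : R, q < t <= T -> sg t <> 0.

Local Notation z := (x q).

Lemma last_zero_lt : q < T.
Proof.
rewrite lt_neqAle; case/andP: q_itv => _ ->; rewrite andbT.
by apply/eqP => qE; have := sd_sgT D; rewrite -qE sgq ltxx.
Qed.

Lemma final_neg t : q < t < T -> sg t < 0.
Proof.
move=> tqT; have [r r0 Hr] := continuous_lt_near (sd_sg D) (sd_sgT D).
pose t0 := Num.max ((q + T) / 2) (T - r / 2).
have qT := last_zero_lt.
have [t0q t0T t0r] : [/\ q < t0, t0 < T & T - r < t0].
  by rewrite /t0; case: (leP ((q + T) / 2) (T - r / 2)) => ?; split; lra_q.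
apply: (nonvanishing_signN (sd_sg D) (a := q) (b := T) (t0 := t0)) => //.
- by move=> u uqT; apply: q_last; lra_q.
- by rewrite t0q.
- by apply: Hr; rewrite ltr_norml; lra_q.
Qed.

Lemma h_last_zero : h z = c.
Proof. exact/(sd_eq D q_itv). Qed.

Lemma last_zero_above : c < z.
Proof. exact: (sd_above D). Qed.

Lemma h_final_lt : h c < c.
Proof.
rewrite -[X in h X](sd_xT D); apply: sd_lt; first by rewrite lexx ltW ?(sd_T D).
by have := sd_sgT D; lra_q.
Qed.

(** The final coasting phase takes every velocity between [c] and [z], and has no
    zero of [sg]. *)
Lemma h_below y : c <= y < z -> h y < c.
Proof.
move=> /andP[]; rewrite le_eqVlt => /orP[/eqP <- _|cy yz]; first exact: h_final_lt.
have [||||t tqT <-] := @sd_between q T y.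
- by case/andP: q_itv.
- exact: ltW last_zero_lt.
- by [].
- by rewrite (sd_xT D) gt_min lt_max cy yz orbT.
apply: sd_lt; first by lra_q.
by apply: q_last; lra_q.
Qed.

(** Two points at which [h] comes up to the level [c] would be separated by a
    point below the level, against [sd_no_second_rise]: [h] is below [c] just to
    the left of each. *)
Lemma crest_unique w w' : h w = c -> w' < w ->
  (forall y : R, w' < y < w -> h y < c) -> w = z.
Proof.
move=> hw w'w hlt; have cz := last_zero_above; have hz := h_last_zero; have hc := h_final_lt.
apply/eqP; rewrite eq_le !leNgt; apply/andP; split; apply/negP => wz.
  pose m := (Num.max w' z + w) / 2.
  have m1 : w' < m /\ z < m < w.
    by rewrite /m; case: (leP w' z) => ?; split; lra_q.
  apply: (@sd_no_second_rise c z m w) => //; try lra_q.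
  - by rewrite hz; apply: hlt; lra_q.
  - by rewrite hw; apply: hlt; lra_q.
pose m := (Num.max w c + z) / 2.
have m1 : w < m /\ c < m < z.
  by rewrite /m; case: (leP w c) => ?; split; lra_q.
have hm : h m < c by apply: h_below; lra_q.
apply: (@sd_no_second_rise ((w' + w) / 2) w m z) => //; try lra_q.
by rewrite hw; apply: hlt; lra_q.
Qed.

Section FirstZero.
Variable p : R.
Hypothesis p_itv : 0 <= p <= q.
Ltac lra_pq := move: q_itv p_itv => ? ?; lra.
Hypothesis sgp : sg p = 0.
Hypothesis p_first : forall t : R, 0 <= t < p -> sg t <> 0.

Lemma zeros_around t : p <= t <= q -> sg t <> 0 ->
  exists a b : R, [/\ p <= a, a < t < b, b <= q, sg a = 0 &
    sg b = 0 /\ forall u : R, a < u < b -> sg u <> 0].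
Proof.
move=> /andP[pt tq] sgt.
have [a [/andP[pa at_] sga Ha]] :=
  @last_preimage _ sg p t 0 p (sd_sg D) ltac:(lra_pq) sgp.
have [b [/andP[tb bq] sgb Hb]] :=
  @first_preimage _ sg t q 0 q (sd_sg D) ltac:(lra_pq) sgq.
have ta : t <> a by move=> E; apply: sgt; rewrite E.
have tb' : t <> b by move=> E; apply: sgt; rewrite E.
exists a, b; split; try lra_pq; split=> // u uab.
by case: (leP u t) => ut; [apply: Ha|apply: Hb]; lra_pq.
Qed.

(** A coasting phase between two zeros would start at [z], by [crest_unique], and
    end at a point of the level in ]c, z[, against [h_below]. *)
Lemma middle_ge0 t : p <= t <= q -> 0 <= sg t.
Proof.
move=> tpq; rewrite leNgt; apply/negP => sgt.
have [|a [b [pa atb bq sga [sgb sgab]]]] := zeros_around tpq; first by lra_pq.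
have qT := last_zero_lt.
have sg_neg u : a < u < b -> sg u < 0.
  exact: (nonvanishing_signN (sd_sg D) sgab atb sgt).
have xba : x b < x a by apply: (sd_fall D) => //; lra_pq.
have hab y : x b < y < x a -> h y < c.
  move=> yb; have [||||u uab <-] := @sd_between a b y; try lra_pq.
    by rewrite gt_min lt_max; apply/andP; split; apply/orP; lra_pq.
  by apply: sd_lt; [lra_pq|exact: sgab].
have xaz : x a = z.
  by apply: (@crest_unique _ (x b)) => //; apply/(sd_eq D); lra_pq.
have cb : c < x b by apply: (sd_above D) => //; lra_pq.
have hb : h (x b) = c by apply/(sd_eq D); lra_pq.
by have := @h_below (x b); rewrite hb -xaz; lra_pq.
Qed.

(** To come down, the velocity would have to cross a point y off the level for the
    last time; but there [sg] > 0 and the velocity rises. This also covers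
    infinitely many zeros of [sg]. *)
Lemma middle_mono s t : p <= s -> s <= t -> t <= q -> x s <= x t.
Proof.
move=> ps st tq; rewrite leNgt; apply/negP => xts.
have qT := last_zero_lt.
have [y /andP[y1 y2] hy] := sd_level D xts.
have [||||u0 u0st xu0] := @sd_between s t y; try lra_pq.
  by rewrite gt_min lt_max; apply/andP; split; apply/orP; lra_pq.
have [u [/andP[u0u ut] xu Hu]] :=
  @last_preimage _ x s t y u0 (sd_x D) ltac:(lra_pq) xu0.
have ut' : u < t.
  by rewrite lt_neqAle ut andbT; apply/eqP => E; move: y1; rewrite -xu E; lra_pq.
have sgu : 0 < sg u.
  rewrite lt_neqAle middle_ge0 ?andbT; last by lra_pq.
  by apply/eqP => /esym /(sd_eq D) E; apply: hy; rewrite -xu E //; lra_pq.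
have : (- sg) u < 0 by rewrite /= oppr_lt0.
have cN : continuous (- sg) by move=> v; apply: continuousN; exact: (sd_sg D).
move=> /(continuous_lt_near cN)[r r0 Hr].
pose v := Num.min (u + r / 2) t.
have [uv vt vr] : [/\ u < v, v <= t & v < u + r].
  by rewrite /v; case: (leP (u + r / 2) t) => ?; split; lra_pq.
have xuv : x u < x v.
  apply: (sd_rise D); try lra_pq.
  by move=> w wuv; rewrite -oppr_lt0; apply: Hr; rewrite ltr_norml; lra_pq.
have [|w wvt xw] := continuous_surj (sd_x D) vt (v := y).
  by rewrite ge_min le_max; apply/andP; split; apply/orP; [right|left]; lra_pq.
by apply: (Hu w) => //; lra_pq.
Qed.

(** A thrust phase ends at [z] by [crest_unique]; as the velocity is monotone and
    ends at [z], it stays there. A singular arc before the thrust phase is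
    excluded because [h] would have a critical point followed by a negative and
    then a positive slope. *)
Lemma middle_rise t : p <= t <= q -> 0 < sg t ->
  exists b : R, [/\ t < b <= q, forall u : R, p < u < b -> 0 < sg u &
    forall u : R, b <= u <= q -> sg u = 0 /\ x u = z].
Proof.
have qT := last_zero_lt.
have one_rise t0 : p <= t0 <= q -> 0 < sg t0 ->
  exists a b : R, [/\ p <= a, a < t0 < b, b <= q, sg a = 0 &
    [/\ forall u : R, a < u < b -> 0 < sg u, x a < z,
     forall y : R, x a < y < z -> h y < c &
     forall u : R, b <= u <= q -> sg u = 0 /\ x u = z]].
  move=> tpq sgt.
  have [|a [b [pa atb bq sga [sgb sgab]]]] := zeros_around tpq; first by lra_pq.
  have sg_pos u : a < u < b -> 0 < sg u.
    exact: (nonvanishing_sign (sd_sg D) sgab atb sgt).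
  have xab : x a < x b by apply: (sd_rise D) => //; lra_pq.
  have hab y : x a < y < x b -> h y < c.
    move=> yb; have [||||u uab <-] := @sd_between a b y; try lra_pq.
      by rewrite gt_min lt_max; apply/andP; split; apply/orP; lra_pq.
    by apply: sd_lt; [lra_pq|exact: sgab].
  have xbz : x b = z.
    by apply: (@crest_unique _ (x a)) => //; apply/(sd_eq D); lra_pq.
  exists a, b; split => //; split => //; rewrite -?xbz // => u /andP[bu uq].
  have xu : x u = z.
    apply/eqP; rewrite eq_le; apply/andP; split.
      by apply: middle_mono; lra_pq.
    by rewrite -xbz; apply: middle_mono; lra_pq.
  by split; rewrite ?xbz //; apply/(sd_eq D); [lra_pq|rewrite xu; exact: h_last_zero].
move=> tpq sgt; have [a [b [pa atb bq sga [sg_pos xaz hlt after]]]] := one_rise t tpq sgt.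
have ap : a = p.
  apply/eqP; rewrite eq_le pa andbT leNgt; apply/negP => pa'.
  have sg0 u : p < u < a -> sg u = 0.
    move=> upa; apply/eqP; rewrite eq_le middle_ge0 ?andbT; last by lra_pq.
    rewrite leNgt; apply/negP => sgu.
    have [|a' [b' [pa'' ub' bq' sga' [sg_pos' _ _ after']]]] := one_rise u _ sgu.
      by lra_pq.
    have ba : b' <= a.
      rewrite leNgt; apply/negP => ab'.
      by have := sg_pos' a; rewrite sga ltxx => /(_ ltac:(lra_pq)).
    by have := after' t ltac:(lra_pq); lra_pq.
  have [||t1 t1b k0] := sd_singular D (a := p) (b := a) _ pa' _ sg0; try lra_pq.
  have xt1 : x t1 <= x a by apply: middle_mono; lra_pq.
  pose m := (x a + z) / 2.
  have hm : h m < c by apply: hlt; rewrite /m; lra_pq.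
  have ha : h (x a) = c by apply/(sd_eq D); lra_pq.
  have [||v2 v2b k2] := @sd_slope_lt0 (x a) m; rewrite ?ha //; first by rewrite /m; lra_pq.
  have [||v3 v3b k3] := @sd_slope_gt0 m z; rewrite ?h_last_zero //; first by rewrite /m; lra_pq.
  by have := @sd_slope_quasiconcave (x t1) v2 v3; rewrite k0; lra_pq.
by exists b; split; [lra_pq|rewrite -ap|].
Qed.

(** The exceptional time [e] is the first zero of [sg] when thrust precedes it:
    both thrust phases, before and after, then merge into one. *)
Lemma phases_from_zeros : exists p' t1 e : R,
  [/\ 0 <= p', p' < t1, t1 <= q &
  [/\ forall t : R, 0 < t < p' -> sg t < 0,
      forall t : R, p' < t < t1 -> t <> e -> 0 < sg t,
      forall t : R, t1 < t < q -> sg t = 0 /\ x t = z &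
      forall t : R, q < t < T -> sg t < 0]].
Proof.
have qT := last_zero_lt; have fin := final_neg.
have p_sign : (forall t : R, 0 < t < p -> sg t < 0) \/
    (0 < p /\ forall t : R, 0 < t < p -> 0 < sg t).
  have [p0|p0] := leP p 0; first by left => u ?; lra_pq.
  have nz t : 0 < t < p -> sg t <> 0 by move=> ?; apply: p_first; lra_pq.
  have mid : 0 < p / 2 < p by lra_pq.
  case: (ltgtP (sg (p / 2)) 0) => [sgm|sgm|/nz]; last by move=> /(_ mid).
  - by left; exact: (nonvanishing_signN (sd_sg D) nz mid sgm).
  - by right; split => //; exact: (nonvanishing_sign (sd_sg D) nz mid sgm).
have [[t [tpq sgt]]|noR] := pselect (exists t : R, p <= t <= q /\ 0 < sg t).
  have [b [tb sgb after]] := middle_rise tpq sgt.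
  have after' u : b < u < q -> sg u = 0 /\ x u = z by move=> ?; apply: after; lra_pq.
  case: p_sign => [neg|[p0 pos]].
  - by exists p, b, p; split; try lra_pq; split => // u ? _; apply: sgb.
  - exists 0, b, p; split; try lra_pq; split => //; first by move=> u ?; lra_pq.
    move=> u ub up; case: (ltgtP u p) => [ltup|gtup|//].
      by apply: pos; lra_pq.
    by apply: sgb; lra_pq.
have mid0 u : p <= u <= q -> sg u = 0.
  move=> upq; apply/eqP; rewrite eq_le middle_ge0 // andbT leNgt.
  by apply/negP => sgu; apply: noR; exists u.
have midz u : p <= u <= q -> x u = z.
  move=> upq; apply/eqP; rewrite eq_le middle_mono ?lexx; try lra_pq.
  rewrite /= leNgt; apply/negP => xuz.
  have [y yb hy] := sd_level D xuz.
  have [||||w wuq xw] := @sd_between u q y; try lra_pq.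
    by rewrite gt_min lt_max; apply/andP; split; apply/orP; lra_pq.
  by apply: hy; rewrite -xw; apply/(sd_eq D); [lra_pq|apply: mid0; lra_pq].
case: p_sign => [neg|[p0 pos]]; last first.
  exists 0, p, p; split; try lra_pq; split => //; first by move=> u ?; lra_pq.
  - by move=> u up _; apply: pos; lra_pq.
  - by move=> u upq; split; [apply: mid0|apply: midz]; lra_pq.
(* The cases left: sg is negative off the single time p, and a singular arc that
   follows an initial coasting phase or starts at time 0. *)
exfalso; have [pq|pq] := ltP p q; last first.
  have [t [tT tp]] := sd_thrust D p.
  suff : sg t < 0 by lra_pq.
  by case: (ltgtP t p) => // ?; [apply: neg|apply: fin]; lra_pq.
have [||t tpq kt] := sd_singular D (a := p) (b := q) _ pq (ltW qT).
- by lra_pq.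
- by move=> u upq; apply: mid0; lra_pq.
rewrite midz in kt; last by lra_pq.
have z0 : z <= 0.
  have <- : x p = z by apply: midz; lra_pq.
  have [p0|p0] := leP p 0.
    have -> : p = 0 by lra_pq.
    by rewrite (sd_x0 D).
  have : x p < x 0 by apply: (sd_fall D) => //; lra_pq.
  by rewrite (sd_x0 D) => /ltW.
have [|v vcz kv] := @sd_slope_gt0 c z last_zero_above; first by rewrite h_last_zero; exact: h_final_lt.
by have := sd_k_incr D (y := v) (w := z); rewrite kt; lra_pq.
Qed.

End FirstZero.
End LastZero.

Lemma switching_phases : exists p t1 q e z : R,
  [/\ 0 <= p, p < t1, t1 <= q, q < T &
  [/\ forall t : R, 0 < t < p -> sg t < 0,
      forall t : R, p < t < t1 -> t <> e -> 0 < sg t,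
      forall t : R, t1 < t < q -> sg t = 0 /\ x t = z &
      forall t : R, q < t < T -> sg t < 0]].
Proof.
have [t0 t0T sgt0] := sd_exists_zero.
have [q [t0q sgq q_last]] := last_preimage (sd_sg D) t0T sgt0.
have [p [pq sgp p_first]] := @first_preimage _ sg 0 q 0 q (sd_sg D) ltac:(lra) sgq.
have q_itv : 0 <= q <= T by lra.
have [p' [t1 [e [p0 pt1 t1q H]]]] :=
  phases_from_zeros q_itv sgq q_last pq sgp p_first.
exists p', t1, q, e, (x q); split => //; exact: (last_zero_lt q_itv sgq).
Qed.

End SwitchingDiagram.

(** * The friction law *)

Section FrictionLaw.
Context {R : realType} (phi : R -> R).
Implicit Types (c v w y : R).
Hypothesis frict : friction_law phi.

Local Notation dphi := (phi^`()%classic).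

Lemma friction_is_derive y : is_derive y 1 phi (dphi y).
Proof.
by apply: DeriveDef; [exact: (friction_derivable frict)|rewrite derive1E].
Qed.

Lemma friction_continuous : continuous phi.
Proof.
move=> y; apply: differentiable_continuous; apply/derivable1_diffP.
exact: (friction_derivable frict).
Qed.

Lemma friction_mvt y w : y < w ->
  exists2 v : R, y < v < w & phi w - phi y = dphi v * (w - y).
Proof.
move=> yw; have [||v + hv] := MVT yw (f := phi) (df := dphi).
- by move=> v _; exact: friction_is_derive.
- exact/continuous_itv/friction_continuous.
by rewrite in_itv /=; exists v.
Qed.

Lemma friction_slope_mvt y w : y < w -> (w < 0) || (0 < y) ->
  exists2 v : R, y < v < w & dphi w - dphi y = phi^`(2)%classic v * (w - y).
Proof.
move=> yw yw0.
have d2 v : v != 0 -> is_derive v 1 dphi (phi^`(2)%classic v).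
  move=> v0; apply: DeriveDef; first exact: (friction_twice_derivable frict).
  by rewrite -derive1E derive1nS.
have nz v : y <= v <= w -> v != 0.
  by move=> yvw; apply/eqP => v0; case/orP: yw0; lra.
have [||v + hv] := MVT yw (f := dphi) (df := phi^`(2)%classic).
- by move=> v; rewrite in_itv /= => yvw; apply: d2; apply: nz; lra.
- apply: derivable_within_continuous => v; rewrite in_itv /= => yvw.
  by apply: (friction_twice_derivable frict); exact: nz.
by rewrite in_itv /=; exists v.
Qed.

Lemma friction_slope_lt_neg y w : y < w -> w < 0 -> dphi w < dphi y.
Proof.
move=> yw w0; have [|v yvw E] := friction_slope_mvt yw; first by rewrite w0.
rewrite -subr_lt0 E pmulr_llt0 ?subr_gt0 //.
by apply: (friction_deriv2_lt0 frict); lra.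
Qed.

Lemma friction_slope_lt_pos y w : 0 < y -> y < w -> dphi y < dphi w.
Proof.
move=> y0 yw; have [|v yvw E] := friction_slope_mvt yw; first by rewrite y0 orbT.
rewrite -subr_gt0 E pmulr_lgt0 ?subr_gt0 //.
by apply: (friction_deriv2_gt0 frict); lra.
Qed.

(** phi'(0) is a limit of difference quotients, which are values of phi' on the
    side of [b]. This extends the monotonicity of phi' up to 0 on either side. *)
Lemma friction_slope0_le (C b : R) : b != 0 ->
  (forall v : R, Num.min b 0 < v < Num.max b 0 -> dphi v <= C) -> dphi 0 <= C.
Proof.
move=> b0 bC; apply/ler_addgt0Pr => e e0.
have [r r0 Hr] := derive_increment (friction_is_derive 0) e0.
case: (ltgtP b 0) b0 bC => // b0 _ bC.
  pose k := Num.max (b / 2) (- r / 2).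
  have [kb kr k0] : [/\ b < k, - r < k & k < 0].
    by rewrite /k; case: (leP (b / 2) (- r / 2)) => ?; split; lra.
  have := Hr k; rewrite ltr0_norm // ltrNl => /(_ kr).
  rewrite ler_norml add0r => /andP[_ H1].
  have [v vk E] := friction_mvt k0.
  have Cv : dphi v <= C by apply: bC; lra.
  have : (C - dphi v) * k <= 0 by nra.
  rewrite -(ler_nM2r k0); nra.
pose k := Num.min (b / 2) (r / 2).
have [kb kr k0] : [/\ k < b, k < r & 0 < k].
  by rewrite /k; case: (leP (b / 2) (r / 2)) => ?; split; lra.
have := Hr k; rewrite gtr0_norm // => /(_ kr).
rewrite ler_norml add0r => /andP[H1 _].
have [v vk E] := friction_mvt k0.
have Cv : dphi v <= C by apply: bC; lra.
have : 0 <= (C - dphi v) * k by nra.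
rewrite -(ler_pM2r k0); nra.
Qed.

Lemma friction_slope_neg y w : y <= w -> w <= 0 -> dphi w <= dphi y.
Proof.
rewrite le_eqVlt => /orP[/eqP -> //|yw]; rewrite le_eqVlt => /orP[/eqP w0|w0].
  rewrite w0 in yw *; apply: (@friction_slope0_le _ y); first by rewrite lt_eqF.
  move=> v; rewrite min_l ?max_r ?(ltW yw) // => /andP[yv v0].
  exact/ltW/friction_slope_lt_neg.
exact/ltW/friction_slope_lt_neg.
Qed.

Lemma friction_slope_pos y w : 0 <= y -> y <= w -> dphi y <= dphi w.
Proof.
move=> + yw; move: (yw); rewrite le_eqVlt => /orP[/eqP -> //|yw'].
rewrite le_eqVlt => /orP[/eqP y0|y0].
  rewrite -y0 in yw' *; apply: (@friction_slope0_le _ w); first by rewrite gt_eqF.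
  move=> v; rewrite min_r ?max_l ?(ltW yw') // => /andP[v0 vw].
  exact/ltW/friction_slope_lt_pos.
exact/ltW/friction_slope_lt_pos.
Qed.

Lemma friction_slope_bound (B v : R) : `|v| <= B -> dphi v <= dphi (- B) + dphi B.
Proof.
rewrite ler_norml => /andP[Bv vB].
have pm := friction_deriv_gt0 frict (- B); have pp := friction_deriv_gt0 frict B.
have [v0|/ltW v0] := leP v 0.
  by have := friction_slope_neg Bv v0; lra.
by have := friction_slope_pos v0 vB; lra.
Qed.

Lemma friction_lipschitz (B v w : R) : `|v| <= B -> `|w| <= B ->
  `|phi v - phi w| <= (dphi (- B) + dphi B) * `|v - w|.
Proof.
wlog vw : v w / v <= w.
  move=> wl vB wB; case: (leP v w) => [|/ltW] ?; first exact: wl.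
  by rewrite distrC (distrC v); apply: wl.
move: vw; rewrite le_eqVlt => /orP[/eqP -> _ _|vw vB wB].
  by rewrite !subrr normr0 mulr0.
have [y yvw E] := friction_mvt vw.
rewrite distrC E normrM (distrC v) ler_wpM2r //.
rewrite gtr0_norm ?(friction_deriv_gt0 frict) //; apply: friction_slope_bound.
by move: vB wB; rewrite !ler_norml; lra.
Qed.

Section Profile.
Variables (g alpha : R).

Definition profile v := v - alpha * (phi v + g).
Definition profile_slope v := 1 - alpha * dphi v.

Lemma profile_is_derive v : is_derive v 1 profile (profile_slope v).
Proof.
have D := friction_is_derive v.
apply: is_derive_eq; rewrite /profile_slope.
by rewrite /GRing.scale /= addr0 /GRing.scale /=.
Qed.

(** Otherwise phi' would take the value 1 / alpha at two points on the same side of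
    0, where it is strictly monotone. *)
Lemma profile_not_constant c y w : 0 < alpha -> y < w ->
  exists2 v : R, y < v < w & profile v <> c.
Proof.
move=> alpha0 yw; apply: contrapT => ncst.
have cst v : y < v < w -> profile v = c.
  by move=> yvw; apply: contrapT => hv; apply: ncst; exists v.
have slope0 v : y < v < w -> alpha * dphi v = 1.
  move=> yvw; suff : profile_slope v = 0 by rewrite /profile_slope; lra.
  apply: (derive_local_min (profile_is_derive v) (r := Num.min (v - y) (w - v))).
    by rewrite lt_min; apply/andP; split; lra.
  by move=> k; rewrite lt_min !ltr_norml => kb; rewrite !cst //; lra.
have alphaI a b : alpha * a = 1 -> alpha * b = 1 -> a = b.
  by move=> Ha Hb; apply: (mulfI (lt0r_neq0 alpha0)); rewrite Ha.
have [w0|w0] := leP w 0.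
  have := @friction_slope_lt_neg ((2 * y + w) / 3) ((y + 2 * w) / 3).
  rewrite (alphaI (dphi ((2 * y + w) / 3)) (dphi ((y + 2 * w) / 3))).
  - by rewrite ltxx => /(_ ltac:(lra) ltac:(lra)).
  - by apply: slope0; lra.
  - by apply: slope0; lra.
pose y' := Num.max y 0.
have [y'y y'0 y'w] : [/\ y <= y', 0 <= y' & y' < w].
  by rewrite /y'; case: (leP y 0) => ?; split; lra.
have := @friction_slope_lt_pos ((2 * y' + w) / 3) ((y' + 2 * w) / 3).
rewrite (alphaI (dphi ((2 * y' + w) / 3)) (dphi ((y' + 2 * w) / 3))).
- by rewrite ltxx => /(_ ltac:(lra) ltac:(lra)).
- by apply: slope0; lra.
- by apply: slope0; lra.
Qed.

End Profile.
End FrictionLaw.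

(** * Trajectories on a time interval *)

Section Trajectories.
Context {R : realType}.
Implicit Types (f w : R -> R) (a b t L T : R).

Definition lipschitz_itv T L f := forall s t : R,
  0 <= s <= T -> 0 <= t <= T -> `|f s - f t| <= L * `|s - t|.

Lemma lipschitz_itvP T f : [lipschitz f t | t in `[0, T]] ->
  exists2 L : R, 0 <= L & lipschitz_itv T L f.
Proof.
move=> [M [_ HM]]; have M1 : M < Num.max 0 (M + 1).
  by rewrite lt_max ltrDl ltr01 orbT.
exists (Num.max 0 (M + 1)); first by rewrite le_max lexx.
move=> s t sT tT; have /= := HM _ M1 (s, t); apply.
by split; rewrite /= in_itv.
Qed.

(** Composing with the projection onto [0, T] extends a function that is only
    controlled there to a continuous function on the line. *)
Definition clamp T t : R := Num.max 0 (Num.min t T).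

Lemma clampP T t : 0 <= T -> [\/ clamp T t = 0 /\ t <= 0,
  clamp T t = t /\ 0 <= t <= T | clamp T t = T /\ T <= t].
Proof.
move=> T0; rewrite /clamp; have [tT|Tt] := leP t T.
  have [t0|t0] := leP 0 t; first by apply: Or32; lra.
  by apply: Or31; lra.
by rewrite max_r //; apply: Or33; lra.
Qed.

Lemma clamp_itv T t : 0 <= T -> 0 <= clamp T t <= T.
Proof. by move=> T0; case: (clampP t T0) => -[-> ?]; lra. Qed.

Lemma clamp_id T t : 0 <= t <= T -> clamp T t = t.
Proof.
by move=> tT; have T0 : 0 <= T; [lra|case: (clampP t T0) => -[-> ?]; lra].
Qed.

Lemma clamp_contract T s t : 0 <= T -> `|clamp T s - clamp T t| <= `|s - t|.
Proof.
move=> T0.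
have := ler_norm (s - t); have := ler_norm (t - s); rewrite distrC ler_norml.
by case: (clampP s T0) => -[-> ?]; case: (clampP t T0) => -[-> ?]; lra.
Qed.

Lemma lipschitz_clamp_continuous T L f : 0 <= T -> 0 <= L ->
  lipschitz_itv T L f -> continuous (f \o clamp T).
Proof.
move=> T0 L0 fL t; apply/cvgrPdist_lt => e e0.
have r0 : 0 < e / (L + 1) by rewrite divr_gt0 //; lra.
near=> s; apply: le_lt_trans (fL _ _ (clamp_itv _ T0) (clamp_itv _ T0)) _.
apply: (@le_lt_trans _ _ (L * (e / (L + 1)))).
  apply: ler_wpM2l => //; apply: le_trans (clamp_contract _ _ T0) _.
  near: s; apply: cvgr_dist_le => //; exact: cvg_id.
rewrite mulrA ltr_pdivrMr; nra.
Unshelve. all: by end_near. Qed.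

Lemma lipschitz_lower T L f s t : lipschitz_itv T L f ->
  0 <= s <= t -> t <= T -> - L * (t - s) <= f t - f s.
Proof.
move=> fL /andP[s0 st] tT; have := fL t s; rewrite s0 tT (le_trans s0) //.
rewrite (le_trans st) // => /(_ isT isT); rewrite (ger0_norm (x := t - s)) ?subr_ge0 //.
by rewrite ler_norml; lra.
Qed.

Lemma lipschitz_opp T L f : lipschitz_itv T L f -> lipschitz_itv T L (fun t => - f t).
Proof.
by move=> fL s t sT tT; rewrite -opprD normrN; exact: fL.
Qed.

Lemma ae_on_point T (P : R -> Prop) a b : ae_on T P ->
  0 <= a -> a < b -> b <= T -> exists2 t : R, a < t < b & P t.
Proof.
move=> aeP a0 ab bT; have [t tab Pt] := ae_interval_point ab aeP.
by exists t => //; apply: Pt; lra.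
Qed.

Lemma ae_on_le T L f (P : R -> Prop) a b : lipschitz_itv T L f -> ae_on T P ->
  0 <= a -> a <= b -> b <= T ->
  (forall t, a < t < b -> P t -> exists2 d : R, 0 <= d & is_derive t 1 f d) ->
  f a <= f b.
Proof.
move=> fL aeP a0 ab bT Pd; apply: (ae_derive_ge0_le (L := L)) ab.
  by move=> s t ast tb; apply: (lipschitz_lower fL); lra.
rewrite /ae_on in aeP; apply: filterS aeP => t Pt tab; by apply: Pd => //; apply: Pt; lra.
Qed.

Lemma ae_on_lt T L f (P : R -> Prop) a b : lipschitz_itv T L f -> ae_on T P ->
  0 <= a -> a < b -> b <= T ->
  (forall t, a < t < b -> P t -> exists2 d : R, 0 < d & is_derive t 1 f d) ->
  f a < f b.
Proof.
move=> fL aeP a0 ab bT Pd; apply: (ae_derive_gt0_lt (L := L)) ab.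
  by move=> s t ast tb; apply: (lipschitz_lower fL); lra.
rewrite /ae_on in aeP; apply: filterS aeP => t Pt tab; by apply: Pd => //; apply: Pt; lra.
Qed.

Lemma ae_on_gt T L f (P : R -> Prop) a b : lipschitz_itv T L f -> ae_on T P ->
  0 <= a -> a < b -> b <= T ->
  (forall t, a < t < b -> P t -> exists2 d : R, d < 0 & is_derive t 1 f d) ->
  f b < f a.
Proof.
move=> /lipschitz_opp fL aeP a0 ab bT Pd; rewrite -ltrN2.
apply: (ae_on_lt fL aeP a0 ab bT) => t tab /(Pd _ tab)[d d0 df].
by exists (- d); [rewrite oppr_gt0|exact: is_deriveN].
Qed.

Lemma ae_on_cst T f (c : R) : continuous f -> ae_on T (fun t => f t = c) ->
  0 < T -> forall t, 0 <= t <= T -> f t = c.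
Proof.
move=> cf aef T0 t tT; apply/eqP; rewrite -subr_eq0 -normr_le0 leNgt.
apply/negP => ftc; have := cf t => /cvgrPdist_lt /(_ _ ftc) [r /= r0 Hr].
pose a := Num.max 0 (t - r); pose b := Num.min T (t + r).
have r0' : (0 : R) < r by [].
have [a0 ab bT] : [/\ 0 <= a, a < b & b <= T].
  rewrite /a /b; case: (leP 0 (t - r)); case: (leP T (t + r)) => ? ?; split; lra.
have [s sab fs] := ae_on_point aef a0 ab bT.
have ar : t - r <= a by rewrite /a le_max lexx orbT.
have br : b <= t + r by rewrite /b ge_min lexx orbT.
have := Hr s; rewrite /ball /= fs ltxx => H; suff : false by []; apply: H.
by rewrite ltr_norml; lra.
Qed.

(** A solution of w' = k (r - w) with r >= 0 is pulled downwards by a force that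
    vanishes with w. If w had a first zero, then on a time interval of length
    at most 1 / (2 K) before it the decrease of w would be at most half of its
    maximum there, so that w could not go from this maximum to 0. *)
Lemma relaxation_positive T L K w (P : R -> Prop) : 0 <= T -> 0 <= L ->
  lipschitz_itv T L w -> ae_on T P -> 0 < w 0 ->
  (forall t, 0 < t < T -> P t -> exists k r : R,
     [/\ 0 <= k <= K, 0 <= r & is_derive t 1 w (k * (r - w t))]) ->
  forall t, 0 <= t <= T -> 0 < w t.
Proof.
move=> T0 L0 wL aeP w0 ode t tT; rewrite ltNge; apply/negP => wt.
have cw := lipschitz_clamp_continuous T0 L0 wL.
have wE s : 0 <= s <= T -> (w \o clamp T) s = w s by move=> sT; rewrite /= clamp_id.
have t0 : 0 <= t by lra.
have [|t1 t1t] := continuous_surj cw t0 (v := 0).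
  rewrite !wE ?lexx // ge_min le_max wt (ltW w0) orbT //.
have t1T : 0 <= t1 <= T by lra.
move=> wt1; have [r [r0t1 + Hr]] := first_preimage cw t1T wt1.
have rT : 0 <= r <= T by lra.
rewrite wE // => wr.
have r0 : 0 < r.
  rewrite lt_neqAle; apply/andP; split; last by lra.
  by apply/eqP => E; move: wr w0; rewrite -E => ->; rewrite ltxx.
have wpos s : 0 <= s < r -> 0 < w s.
  move=> sr; rewrite ltNge; apply/negP => ws.
  have s0 : 0 <= s by lra.
  have [|s1 s1s] := continuous_surj cw s0 (v := 0).
    rewrite !wE ?lexx //; last by lra.
    by rewrite ge_min le_max ws (ltW w0) orbT.
  by apply: Hr; lra.
pose K1 := Num.max K 0 + 1.
have [KK1 K10] : K <= K1 /\ 0 < K1 by rewrite /K1; case: (leP K 0) => ?; split; lra.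
pose r1 := Num.max 0 (r - (2 * K1)^-1).
have iK : 0 < (2 * K1)^-1 by rewrite invr_gt0; lra.
have iKE : K1 * (2 * K1)^-1 = 2^-1 by field; lra.
have [r10 r1r rr1] : [/\ 0 <= r1, r1 < r & r - r1 <= (2 * K1)^-1].
  by rewrite /r1; case: (leP 0 (r - (2 * K1)^-1)) => ?; split; lra.
have [s + smax] := EVT_max (ltW r1r) (continuous_itv cw).
rewrite in_itv /= => sr.
have sT : 0 <= s <= T by lra.
have max_w v : r1 <= v <= r -> w v <= w s.
  by move=> vr; have := smax v; rewrite in_itv !wE //; [apply|lra].
have ws : 0 < w s.
  by apply: lt_le_trans (max_w r1 _); [apply: wpos|]; lra.
pose M := w s.
have : w s + K1 * M * s <= w r + K1 * M * r.
  have fL : lipschitz_itv T (L + K1 * M) (fun v => w v + K1 * M * v).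
    move=> v v' vT v'T.
    have -> : w v + K1 * M * v - (w v' + K1 * M * v') = (w v - w v') + K1 * M * (v - v').
      by ring.
    have KM : `|K1 * M * (v - v')| = K1 * M * `|v - v'|.
      by rewrite normrM (ger0_norm (x := K1 * M)) // mulr_ge0 // ltW.
    have := ler_normD (w v - w v') (K1 * M * (v - v')).
    by have := wL v v' vT v'T; rewrite KM; lra.
  apply: (ae_on_le fL aeP); try lra.
  move=> v vsr Pv; have [|k [ro [kK ro0 dw]]] := ode v _ Pv; first by lra.
  exists (k * (ro - w v) + K1 * M).
    have wv0 : 0 <= w v by apply/ltW/wpos; lra.
    have wvM : w v <= M by apply: max_w; lra.
    have : k * w v <= K1 * M by apply: ler_pM => //; lra.
    have : 0 <= k * ro by apply: mulr_ge0 => //; lra.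
    by lra.
  have dlin : is_derive v 1 (fun v : R => K1 * M * v) (K1 * M).
    by apply: is_derive_eq; rewrite /GRing.scale /= mulr1.
  exact: is_deriveD.
rewrite wr add0r -/M => H.
have : K1 * M * (r - s) <= K1 * M * (2 * K1)^-1.
  by apply: ler_wpM2l; [rewrite mulr_ge0 // ltW|lra].
have -> : K1 * M * (2 * K1)^-1 = M / 2 by rewrite mulrAC iKE mulrC.
have : 0 < M by [].
lra.
Qed.

End Trajectories.

(** * Extremals *)

Section Extremals.
Context {R : realType} (T g m0 mT : R) (phi : R -> R).
Context (s x m u : R -> R) (alpha : R) (psi : R -> R).
Hypothesis T_gt0 : 0 < T.
Hypothesis g_itv : 0 < g < 1.
Hypothesis dm_itv : 0 < m0 - mT < T.
Hypothesis frict : friction_law phi.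
Hypothesis ext : extremal T g m0 mT phi s x m u alpha psi.
Implicit Types (a b t : R).

Local Notation adm := (ext_admissible ext).
Local Notation dphi := (phi^`()%classic).

Let T_ge0 : 0 <= T. Proof. exact: ltW. Qed.

Definition regular_time t :=
  [/\ is_derive t (1 : R) x (u t - phi (x t) - g),
      is_derive t (1 : R) m (- u t),
      is_derive t (1 : R) psi (- 1 + psi t * dphi (x t)),
      0 <= u t <= 1 &
      (alpha < psi t -> u t = 1) /\ (psi t < alpha -> u t = 0)].

Lemma ae_regular_time : ae_on T regular_time.
Proof.
have H1 := adm_x_ode adm; have H2 := adm_m_ode adm; have H3 := ext_psi_ode ext.
have H4 := adm_u_range adm; have H5 := ext_maximum ext; rewrite /ae_on in H1 H2 H3 H4 H5 *.
apply: filterS2 (filterI H1 (filterI H2 H3)) (filterI H4 H5).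
move=> t [] h1 [h2 h3] [h4 h5] tT; have [h6 h7 _] := h5 tT.
by split; [exact: h1|exact: h2|exact: h3|exact: h4|split].
Qed.

Lemma x_clamp_continuous : continuous (x \o clamp T).
Proof.
have [L L0 xL] := lipschitz_itvP (adm_x_lipschitz adm).
exact: lipschitz_clamp_continuous xL.
Qed.

Lemma psi_clamp_continuous : continuous (psi \o clamp T).
Proof.
have [L L0 xL] := lipschitz_itvP (ext_psi_lipschitz ext).
exact: lipschitz_clamp_continuous xL.
Qed.

(** Both phi(x) + g and 1 - (phi(x) + g) satisfy a relaxation equation with rate
    phi'(x), towards u and 1 - u respectively, and are positive at time 0: the
    velocity never reaches the limit velocities of free fall and full thrust. *)
Lemma friction_plus_g_range t : 0 <= t <= T -> 0 < phi (x t) + g < 1.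
Proof.
move=> tT; have [L L0 xL] := lipschitz_itvP (adm_x_lipschitz adm).
pose B := L * T; pose K := dphi (- B) + dphi B.
have K0 : 0 <= K by rewrite addr_ge0 // ltW // (friction_deriv_gt0 frict).
have xB v : 0 <= v <= T -> `|x v| <= B.
  move=> vT; have T0 := T_ge0; have := xL v 0 vT; rewrite (adm_x0 adm) !subr0 lexx.
  move=> /(_ T0) /le_trans; apply; apply: ler_wpM2l => //.
  by rewrite ger0_norm; lra.
pose w v := phi (x v) + g.
have wL : lipschitz_itv T (K * L) w.
  move=> v v' vT v'T; have -> : w v - w v' = phi (x v) - phi (x v') by rewrite /w; ring.
  apply: le_trans (friction_lipschitz frict (xB _ vT) (xB _ v'T)) _.
  by rewrite -mulrA ler_wpM2l //; exact: xL.
have KL0 : 0 <= K * L by rewrite mulr_ge0.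
have k_range v : 0 < v < T -> 0 <= dphi (x v) <= K.
  move=> vT; rewrite ltW ?(friction_deriv_gt0 frict) //=.
  by apply: (friction_slope_bound frict); apply: xB; lra.
have dw v : regular_time v -> is_derive v 1 w (dphi (x v) * (u v - w v)).
  move=> [dx _ _ _ _].
  have dp := is_derive1_comp (friction_is_derive frict (x v)) dx.
  apply: is_derive_eq; rewrite addr0 /w; ring.
have gi := g_itv; have x0 := adm_x0 adm; have p0 := friction0 frict.
apply/andP; split.
  apply: (relaxation_positive T_ge0 KL0 wL ae_regular_time) => //.
    by rewrite /w x0 p0; lra.
  move=> v vT Rv; exists (dphi (x v)), (u v); split; [exact: k_range| |exact: dw].
  by case: Rv => _ _ _; lra.
rewrite -subr_gt0.
apply: (@relaxation_positive _ T (K * L) K (fun v => 1 - w v) regular_time) => //.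
- move=> v v' vT v'T; have -> : 1 - w v - (1 - w v') = - (w v - w v') by ring.
  by rewrite normrN; exact: wL.
- exact: ae_regular_time.
- by rewrite /w x0 p0; lra.
move=> v vT Rv; exists (dphi (x v)), (1 - u v); split; first exact: k_range.
  by case: Rv => _ _ _; lra.
have dwv := dw v Rv; apply: is_derive_eq; ring.
Qed.

(** The maximum condition gives (psi - alpha) u = max(psi - alpha, 0), written here
    with an absolute value; this makes the Hamiltonian continuous, hence constant
    everywhere, and its value is found at T. *)
Lemma hamiltonian_eq t : 0 <= t <= T ->
  x t - psi t * (phi (x t) + g) + (psi t - alpha + `|psi t - alpha|) / 2 = x T.
Proof.
have [c aeH] := ext_hamiltonian_cst ext.
pose H y p := y - p * (phi y + g) + (p - alpha + `|p - alpha|) / 2.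
have cX := x_clamp_continuous; have cP := psi_clamp_continuous.
pose F v := H ((x \o clamp T) v) ((psi \o clamp T) v).
have cF : continuous F.
  move=> v; have hX := cX v; have hP := cP v.
  have hphi : phi ((x \o clamp T) w) @[w --> v] --> phi ((x \o clamp T) v).
    by apply: continuous_comp hX _; exact: friction_continuous.
  have hS : (psi \o clamp T) w - alpha @[w --> v] --> (psi \o clamp T) v - alpha.
    by apply: cvgB hP _; exact: cvg_cst.
  rewrite /continuous_at /F /H.
  apply: (@cvgD _ _ _ _ _ (fun w : R => (x \o clamp T) w -
    (psi \o clamp T) w * (phi ((x \o clamp T) w) + g))).
    apply: cvgB; first exact: hX.
    by apply: cvgM; [exact: hP|apply: cvgD; [exact: hphi|exact: cvg_cst]].
  apply: cvgM; last exact: cvg_cst.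
  by apply: cvgD; [exact: hS|exact: cvg_norm hS].
have Fc : forall v, 0 <= v <= T -> F v = c.
  apply: ae_on_cst cF _ T_gt0; have Rt := ae_regular_time.
  rewrite /ae_on in aeH Rt *; apply: filterS2 aeH Rt => v Hv Rv vT.
  have [_ _ _ _ [u1 u0]] := Rv vT; rewrite -(Hv vT) /F /H /= clamp_id; last by lra.
  case: (ltgtP (psi v) alpha) => [lt|gt|->].
  - rewrite (u0 lt) (ltr0_norm (x := _ - _)) ?subr_lt0 //; lra.
  - rewrite (u1 gt) (gtr0_norm (x := _ - _)) ?subr_gt0 //; lra.
  - by rewrite subrr normr0; lra.
move=> tT; have T0 := T_gt0.
have := Fc t tT; have := Fc T; rewrite /F /H /= !clamp_id //; last by lra.
rewrite (ext_psiT ext) sub0r normrN (ger0_norm (ext_alpha_ge0 ext)) => E1 ->.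
by rewrite -E1; lra.
Qed.

(** Where psi < 0 it decreases, so it could not come back to psi(T) = 0. *)
Lemma psi_ge0 t : 0 <= t <= T -> 0 <= psi t.
Proof.
move=> tT; rewrite leNgt; apply/negP => pt.
have [L L0 pL] := lipschitz_itvP (ext_psi_lipschitz ext).
have cP := psi_clamp_continuous; have T0 := T_gt0.
have pT : (psi \o clamp T) T = 0 by rewrite /= clamp_id ?(ext_psiT ext) //; lra.
have tTT : t <= T <= T by lra.
have [r [rt + Hr]] := first_preimage cP tTT pT.
rewrite /= clamp_id => [pr|]; last by lra.
have tr : t < r.
  rewrite lt_neqAle; apply/andP; split; last by lra.
  by apply/eqP => E; rewrite -E in pr; lra.
have neg v : t < v < r -> psi v < 0.
  move=> vr; rewrite ltNge; apply/negP => pv.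
  have tv : t <= v by lra.
  have [|v1 v1t] := continuous_surj cP tv (v := 0).
    by rewrite /= !clamp_id ?ge_min ?le_max ?pv ?(ltW pt) ?orbT //; lra.
  by apply: Hr; lra.
have : psi r < psi t.
  apply: (ae_on_gt pL ae_regular_time); try lra.
  move=> v vr [_ _ dp _ _]; exists (- 1 + psi v * dphi (x v)) => //.
  have := friction_deriv_gt0 frict (x v); have := neg v vr; nra.
by rewrite pr; lra.
Qed.

(** If alpha = 0, then u = 1 wherever psi > 0. At a regular time with psi = 0 the
    derivative of psi would be -1, although psi >= 0 has a minimum there. So
    u = 1 almost everywhere and the fuel consumption would be T. *)
Lemma alpha_gt0 : 0 < alpha.
Proof.
have T0 := T_gt0; have dm := dm_itv.
rewrite lt_neqAle (ext_alpha_ge0 ext) andbT; apply/eqP => alpha0.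
have [L L0 mL] := lipschitz_itvP (adm_m_lipschitz adm).
have fL : lipschitz_itv T (L + 1) (fun t => - m t - t).
  move=> v v' vT v'T; have := mL v v' vT v'T.
  have -> : - m v - v - (- m v' - v') = - ((m v - m v') + (v - v')) by ring.
  by rewrite normrN; have := ler_normD (m v - m v') (v - v'); lra.
have : - m 0 - 0 <= - m T - T.
  apply: (ae_on_le fL ae_regular_time); try lra.
  move=> v vT [_ dmv dp _ [u1 _]]; exists (u v - 1); last first.
    by apply: is_derive_eq; rewrite opprK.
  have pv : 0 <= psi v by apply: psi_ge0; lra.
  rewrite u1 ?subrr // -alpha0 lt_neqAle pv andbT; apply/eqP => pv0.
  have : - 1 + psi v * dphi (x v) = 0.
    apply: (derive_local_min dp (r := Num.min v (T - v))).
      by rewrite lt_min; apply/andP; split; lra.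
    move=> k; rewrite lt_min !ltr_norml => kb; rewrite -pv0; apply: psi_ge0; lra.
  by rewrite -pv0; lra.
by have := adm_mT adm; rewrite (adm_m0 adm); lra.
Qed.

(** With w = phi(x) + g, the Hamiltonian identity reads
    h(x) - x(T) = (sg (2 w - 1) - |sg|) / 2, which is negative unless sg = 0
    because 0 < w < 1. *)
Lemma ext_switching_diagram : switching_diagram T (x T) (x \o clamp T)
  (fun t => psi (clamp T t) - alpha) (profile phi g alpha) (profile_slope phi alpha).
Proof.
have T0 := T_gt0; have al0 := alpha_gt0.
have [L L0 xL] := lipschitz_itvP (adm_x_lipschitz adm).
have h_gap t : 0 <= t <= T ->
    let w := phi (x t) + g in let sg := psi t - alpha in
    profile phi g alpha (x t) - x T = (sg * (2 * w - 1) - `|sg|) / 2.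
  by move=> tT w sg; rewrite -(hamiltonian_eq tT) /profile -/w -/sg /sg; lra.
have h_lt t : 0 <= t <= T -> psi t != alpha ->
    profile phi g alpha (x t) < x T.
  move=> tT; have wr := friction_plus_g_range tT; rewrite -subr_lt0 h_gap //=.
  case: (ltgtP (psi t) alpha) => // pa _.
    rewrite (ltr0_norm (x := _ - _)) ?subr_lt0 //; nra.
  rewrite (gtr0_norm (x := _ - _)) ?subr_gt0 //; nra.
have h_eq t : 0 <= t <= T -> psi t = alpha ->
    profile phi g alpha (x t) = x T.
  move=> tT pa; apply/eqP; rewrite -subr_eq0 h_gap //= pa subrr normr0.
  by apply/eqP; lra.
split => //.
- exact: x_clamp_continuous.
- by move=> t; apply: cvgB; [exact: psi_clamp_continuous|exact: cvg_cst].
- exact: (profile_is_derive frict).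
- move=> y w yw w0; have := friction_slope_neg frict yw w0.
  rewrite /profile_slope; nra.
- move=> y w y0 yw; have := friction_slope_pos frict y0 yw.
  rewrite /profile_slope; nra.
- by move=> y w; apply: (profile_not_constant frict).
- by rewrite /= clamp_id ?(adm_x0 adm) // lexx ltW.
- by rewrite /= clamp_id // lexx ltW.
- by rewrite clamp_id ?(ext_psiT ext) ?lexx ?ltW //; lra.
- move=> t tT; rewrite /= clamp_id //.
  by have [/(h_eq _ tT) ->|/(h_lt _ tT)/ltW] := eqVneq (psi t) alpha.
- move=> t tT; rewrite /= clamp_id //; split.
    move=> hx; apply/eqP; rewrite subr_eq0; apply/negPn/negP => /(h_lt _ tT).
    by rewrite hx ltxx.
  by move/eqP; rewrite subr_eq0 => /eqP/(h_eq _ tT).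
- move=> t tT; rewrite /= clamp_id // => /eqP; rewrite subr_eq0 => /eqP pa.
  have := friction_plus_g_range tT; rewrite -(h_eq _ tT pa) /profile.
  by move=> /andP[w0 _]; rewrite ltrBlDr ltrDl mulr_gt0.
- move=> a b a0 ab bT neg; rewrite /= !clamp_id; try lra.
  apply: (ae_on_gt xL ae_regular_time) => // t tab [dx _ _ _ [_ u0]].
  exists (u t - phi (x t) - g) => //.
  have := neg t tab; rewrite clamp_id; last by lra.
  rewrite subr_lt0 => /u0 ->; have := @friction_plus_g_range t; lra.
- move=> a b a0 ab bT pos; rewrite /= !clamp_id; try lra.
  apply: (ae_on_lt xL ae_regular_time) => // t tab [dx _ _ _ [u1 _]].
  exists (u t - phi (x t) - g) => //.
  have := pos t tab; rewrite clamp_id; last by lra.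
  rewrite subr_gt0 => /u1 ->; have := @friction_plus_g_range t; lra.
- move=> a b a0 ab bT zero.
  have pa v : a < v < b -> psi v = alpha.
    move=> vab; have := zero v vab; rewrite clamp_id; last by lra.
    by move/eqP; rewrite subr_eq0 => /eqP.
  have [t tab [_ _ dp _ _]] := ae_on_point ae_regular_time a0 ab bT.
  exists t => //; rewrite /= clamp_id; last by lra.
  have : - 1 + psi t * dphi (x t) = 0.
    apply: (derive_local_min dp (r := Num.min (t - a) (b - t))).
      by rewrite lt_min; apply/andP; split; lra.
    by move=> k; rewrite lt_min !ltr_norml => kb; rewrite !pa //; lra.
  by rewrite pa // /profile_slope; lra.
move=> e; apply: contrapT => nthrust.
have [Lm Lm0 mL] := lipschitz_itvP (adm_m_lipschitz adm).
have : m 0 <= m T.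
  have aeP : ae_on T (fun t => regular_time t /\ t <> e).
    have Rt := ae_regular_time; rewrite /ae_on in Rt *.
    by apply: filterS2 Rt (ae_neq e) => t Rt te tT; split => //; exact: Rt.
  apply: (ae_on_le mL aeP); rewrite ?lexx ?ltW // => t tT [[_ dmv _ _ [_ u0]] te].
  exists (- u t) => //; rewrite u0 ?oppr0 // ltNge; apply/negP => pa.
  by apply: nthrust; exists t; split => //; rewrite clamp_id ?subr_ge0 //; lra.
have /eqP := ext_complementarity ext; rewrite mulf_eq0 (gt_eqF al0) /= subr_eq0.
by move=> /eqP ->; rewrite (adm_m0 adm); have dm := dm_itv; lra.
Qed.

End Extremals.

(** * Types of extremals *)

Theorem mainTheorem1 (R : realType) (T g m0 mT : R) (phi : R -> R)
    (T_gt0 : 0 < T)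
    (g_itv : 0 < g < 1)
    (m_itv : 0 < mT < m0)
    (dm_itv : 0 < m0 - mT < T)
    (phi_friction : friction_law phi)
    (s x m u : R -> R) (alpha : R) (psi : R -> R)
    (ext : extremal T g m0 mT phi s x m u alpha psi) :
  exists v : R -> R,
    ae_on T (fun t => v t = u t) /\
    (type_Ia T v \/
     type_Ib T g phi x alpha psi v \/
     type_IIa T v \/
     type_IIb T g phi x alpha psi v \/
     type_III T v).
Proof.
have sd := ext_switching_diagram T_gt0 g_itv dm_itv phi_friction ext.
have [p [t1 [q [e [z [p0 pt1 t1q qT [neg pos sing fin]]]]]]] := switching_phases sd.
pose v t := if t < p then 0 else if t < t1 then 1 else
  if t < q then phi (x t) + g else 0.
have psi_neg t : 0 < t < T -> t < p \/ q < t -> psi t < alpha.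
  move=> tT tpq; rewrite -subr_lt0 -[in psi t](@clamp_id _ T t); last by lra.
  by case: tpq => ?; [apply: neg|apply: fin]; lra.
have psi_pos t : p < t < t1 -> t <> e -> alpha < psi t.
  move=> tpt1 te; rewrite -subr_gt0 -[in psi t](@clamp_id _ T t); last by lra.
  exact: pos.
have psi_sing t : t1 < t < q -> psi t = alpha /\ x t = z.
  move=> tt1q; have [/eqP + <-] := sing t tt1q.
  by rewrite /= clamp_id ?subr_eq0 => [/eqP ->|] //; lra.
have v_rise t : p < t < t1 -> v t = 1.
  by move=> /andP[pt tt1]; rewrite /v ltNge (ltW pt) /= tt1.
have v_sing t : t1 < t < q -> v t = phi (x t) + g.
  move=> /andP[t1t tq]; rewrite /v ltNge (ltW (lt_trans pt1 t1t)) /=.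
  by rewrite ltNge (ltW t1t) /= tq.
have v_fin t : q < t -> v t = 0.
  move=> qt; have t1t := le_lt_trans t1q qt; rewrite /v.
  by rewrite ltNge (ltW (lt_trans pt1 t1t)) /= ltNge (ltW t1t) /= ltNge (ltW qt).
exists v; split.
  have Rt := ae_regular_time ext; rewrite /ae_on in Rt *.
  apply: filterS2 (filterI Rt (filterI (ae_neq p) (ae_neq e)))
    (filterI (ae_neq t1) (ae_neq q)).
  move=> t [Ht [tp te]] [tt1 tq] tT; have [dx _ _ _ [u1 u0]] := Ht tT.
  case: (ltgtP t p) => // [ltp|gtp].
    by rewrite /v ltp u0 //; apply: psi_neg; auto.
  case: (ltgtP t t1) => // [lt1|gt1].
    by rewrite v_rise ?u1 //; [apply: psi_pos|]; rewrite ?gtp.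
  case: (ltgtP t q) => // [ltq|gtq]; last first.
    by rewrite v_fin ?u0 //; apply: psi_neg; auto.
  rewrite v_sing ?gt1 //; suff : u t - phi (x t) - g = 0 by lra.
  apply: (derive_local_min dx (r := Num.min (t - t1) (q - t))).
    by rewrite lt_min; apply/andP; split; lra.
  move=> k; rewrite lt_min !ltr_norml => kb.
  have [_ ->] := psi_sing t ltac:(lra).
  by have [_ ->] := psi_sing (t + k) ltac:(lra).
have fin_cst : ctrl_cst v 0 q T by move=> t /andP[qt _]; exact: v_fin.
have rise_cst : ctrl_cst v 1 p t1 by move=> t; exact: v_rise.
have sing_cst : ctrl_sing g phi x alpha psi v t1 q.
  by move=> t tt; split; [case: (psi_sing t tt)|exact: v_sing].
have start_cst : ctrl_cst v 0 0 p by move=> t /andP[_ tp]; rewrite /v tp.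
have [p_gt0|p_le0] := ltP 0 p; last first.
  have p_eq0 : p = 0 by lra.
  rewrite p_eq0 in rise_cst pt1.
  move: t1q; rewrite le_eqVlt => /orP[/eqP t1q|t1q].
    by left; exists t1; split=> //; rewrite ?pt1 ?t1q.
  by right; left; exists t1, q.
move: t1q; rewrite le_eqVlt => /orP[/eqP t1q|t1q].
  by right; right; left; exists p, t1; rewrite t1q in pt1 rise_cst *.
by right; right; right; left; exists p, t1, q.
Qed.
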